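(* Let $\mathcal H$ be a real Hilbert space and let $f:\mathcal H\to\mathbb R$ be convex and Fréchet differentiable, with $L$-Lipschitz continuous gradient for some $L>0$, and with $X^\star:=\arg\min_{\mathcal H} f\neq\varnothing$; put $f^\star:=\min_{\mathcal H}f$. Let $\alpha\ge 3$, $0<s\le 1/L$, $\beta>0$, and let $(x_k)_{k\ge 0}$, $(y_k)_{k\ge 1}$ be generated by IGAHD (see context) from arbitrary $x_0,x_1\in\mathcal H$. If $$0<\beta L\sqrt{s}<2,$$ then: for a fixed $x^\star\in X^\star$, the energy sequence $(\mathcal E_k)$ (see context) is nonincreasing from some index onward; $f(x_k)-f^\star=O(k^{-2})$; $$\sum_{k=1}^{+\infty}k^2\|\nabla f(x_k)\|^2<+\infty,\qquad \sum_{k=1}^{+\infty}k^2\|\nabla f(y_k)\|^2<+\infty;$$ $\|\nabla f(x_k)\|=o(k^{-1})$ and $\|\nabla f(y_k)\|=o(k^{-1})$; and $$\min_{1\le i\le k}\|\nabla f(x_i)\|^2=O(k^{-3}),\qquad \min_{1\le i\le k}\|\nabla f(y_i)\|^2=O(k^{-3}).$$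
   Context: IGAHD: given $x_0,x_1\in\mathcal H$, for $k\ge1$, $$a_k=1-\frac{\alpha}{k},\qquad y_k=x_k+a_k(x_k-x_{k-1})-\beta\sqrt{s}\,\bigl(\nabla f(x_k)-\nabla f(x_{k-1})\bigr)-\frac{\beta\sqrt{s}}{k}\nabla f(x_{k-1}),\qquad x_{k+1}=y_k-s\nabla f(y_k).$$ Energy: for $k\ge 1$ let $\tau_k:=\frac{k-1}{\alpha-1}$ and, for a fixed $x^\star\in X^\star$, $$v_k:=x_{k-1}-x^\star+\tau_k\bigl(x_k-x_{k-1}+\beta\sqrt{s}\,\nabla f(x_{k-1})\bigr),\qquad \mathcal E_k:=\tau_k^2\bigl(f(x_k)-f^\star\bigr)+\frac{1}{2s}\|v_k\|^2.$$ *)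

(* Defs.v *)
From HB Require Import structures.
From mathcomp Require Import all_boot all_order all_algebra.
From mathcomp Require Import all_classical all_reals all_analysis.

Set Implicit Arguments.
Unset Strict Implicit.
Unset Printing Implicit Defensive.

Import Order.TTheory GRing.Theory Num.Theory.
Import numFieldNormedType.Exports.

Local Open Scope classical_set_scope.
Local Open Scope ring_scope.

HB.mixin Record isHilbert (R : realType) H of CompleteNormedModule R H := {
  inner : {dot H for idfun} ;
  inner_norm : forall x : H, inner x x = `|x| ^+ 2
}.

#[short(type="hilbertType")]
HB.structure Definition Hilbert (R : realType) :=
  {H of isHilbert R H & CompleteNormedModule R H}.

Section IGAHD.
Context {R : realType} {H : hilbertType R}.
Implicit Types (f : H -> R) (x y : nat -> H) (alpha beta s : R) (k : nat).

(* The Riesz representative of the Fréchet derivative 'd f x. It exists (and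
   is unique) as soon as f is differentiable at x. *)
Definition gradient f (x : H) : H :=
  get [set g : H | forall h : H, 'd f x h = inner g h].

Definition argmin f : set H := [set x | forall z, f x <= f z].

(* This is min f whenever argmin f is nonempty. *)
Definition minval f : R := inf (range f).

(* y 0 is unconstrained. *)
Definition IGAHD f alpha beta s x y : Prop :=
  forall k, (1 <= k)%N ->
    y k = x k + (1 - alpha / k%:R) *: (x k - x k.-1)
          - (beta * Num.sqrt s) *: (gradient f (x k) - gradient f (x k.-1))
          - (beta * Num.sqrt s / k%:R) *: gradient f (x k.-1)
    /\ x k.+1 = y k - s *: gradient f (y k).

(* The following three are meant for k >= 1. *)
Definition tau alpha k : R := (k%:R - 1) / (alpha - 1).

Definition vseq f alpha beta s x (xstar : H) k : H :=
  x k.-1 - xstar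
  + tau alpha k *: (x k - x k.-1
                    + (beta * Num.sqrt s) *: gradient f (x k.-1)).

Definition energy f alpha beta s x (xstar : H) k : R :=
  tau alpha k ^+ 2 * (f (x k) - minval f)
  + (2 * s)^-1 * `|vseq f alpha beta s x xstar k| ^+ 2.

End IGAHD.

(* For k >= 1 the default value u 1 is itself one of the terms. *)
Definition running_min {R : realType} (u : nat -> R) (k : nat) : R :=
  \big[Num.min/u 1%N]_(1 <= i < k.+1) u i.

(* Main.v *)
Require Import Defs.
From HB Require Import structures.
From mathcomp Require Import all_boot all_order all_algebra.
From mathcomp Require Import all_classical all_reals all_analysis.
From mathcomp Require Import ring lra.

(** Write g for the gradient of f at x_k, G for the gradient at y_k,
gamma = beta L sqrt s and t = tau_(k+1).

The vectors v_k are chosen so that the inertial, Hessian and vanishing terms of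
the scheme cancel: v_(k+1) = v_k - s t G ([vseq_succ]), and v_k is also
y_k - xstar + (t - 1) (y_k - x_k) + t beta (sqrt s) g ([vseq_extrapolation]).
Expanding |v_(k+1)|^2 thus produces inner products of G with y_k - xstar, with
y_k - x_k and with g. The first two are bounded below by convexity; for the
second, the sharp form of the tangent inequality for convex functions with
L-Lipschitz gradient ([convex_ge_tangent_gradient]) is used, and it contributes
an extra |g - G|^2 / (2 L). The positive term in |G|^2 is absorbed by the
decrease of f along the gradient step, the values f(y_k) cancel, and the
coefficient left in front of f(x_k) - min f is nonpositive because alpha >= 3
([tau_recurrence]). What remains
([energy_step]) is

  E_(k+1) - E_k
    <= - t^2 / (2 L) ( gamma/2 |g + G|^2 + (1 - gamma/2 - 1/t) |g - G|^2 ).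

The indefinite product of g and G, brought in by the Hessian correction, has
been diagonalized by polarization, and here 0 < gamma < 2 enters: as t tends to
infinity, both coefficients are eventually bounded below by a positive constant.
By the parallelogram law, k^2 (|g|^2 + |G|^2) is then at most a constant times
E_k - E_(k+1) ([energy_decrease]).

The conclusions follow. The energy is eventually nonincreasing, hence bounded,
and it dominates tau_k^2 (f(x_k) - min f), which gives the O(1/k^2) rate. Its
decrements telescope, so both sums of k^2 times squared gradient norms converge;
their terms tend to 0, which is the o(1/k) rate, and since 1^2 + ... + k^2 is
of order k^3, the running minima are O(1/k^3).

The gradient itself is only defined through a representing vector of the
differential, so the Riesz representation theorem is proved as well
([riesz_representation]). *)

Import Order.TTheory GRing.Theory Num.Theory.
Import numFieldNormedType.Exports.

Local Open Scope classical_set_scope.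
Local Open Scope ring_scope.

(** * Inner product *)

Section InnerProduct.
Context {R : realType} {H : hilbertType R}.
Implicit Types u v w : H.

Lemma innerC u v : inner u v = inner v u.
Proof. by have := hermC inner u v; rewrite expr0 mul1r. Qed.

Lemma innerDl u v w : inner (u + v) w = inner u w + inner v w.
Proof. exact: linearDl. Qed.

Lemma innerNl u w : inner (- u) w = - inner u w.
Proof. exact: linearNl. Qed.

Lemma innerZl (a : R) u w : inner (a *: u) w = a * inner u w.
Proof. exact: linearZl_LR. Qed.

Lemma innerDr u v w : inner w (u + v) = inner w u + inner w v.
Proof. by rewrite innerC innerDl !(innerC _ w). Qed.

Lemma innerNr u w : inner w (- u) = - inner w u.
Proof. by rewrite innerC innerNl innerC. Qed.

Lemma innerZr (a : R) u w : inner w (a *: u) = a * inner w u.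
Proof. by rewrite innerC innerZl innerC. Qed.

Definition innerE :=
  (innerDl, innerNl, innerZl, innerDr, innerNr, innerZr).

(** Testing against an arbitrary vector turns an identity between linear
combinations of vectors into an identity of scalars, within reach of [ring]. *)
Lemma inner_inj u v : (forall w, inner u w = inner v w) -> u = v.
Proof.
move=> uv; apply/eqP; rewrite -subr_eq0 -normr_eq0 -sqrf_eq0 -inner_norm.
by rewrite innerDl innerNl uv subrr.
Qed.

Lemma inner_ge0 u : 0 <= inner u u.
Proof. by rewrite inner_norm sqr_ge0. Qed.

(** The Cauchy-Schwarz inequality, from the nonnegativity of
| |v| u - |u| v |^2. *)
Lemma inner_le_norm u v : inner u v <= `|u| * `|v|.
Proof.
have [->|u0] := eqVneq u 0.
  by rewrite -[X in inner X _](scale0r (0 : H)) innerZl mul0r mulr_ge0.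
have [->|v0] := eqVneq v 0.
  by rewrite -[X in inner _ X](scale0r (0 : H)) innerZr mul0r mulr_ge0.
have nu : 0 < `|u| by rewrite normr_gt0.
have nv : 0 < `|v| by rewrite normr_gt0.
have := inner_ge0 (`|v| *: u - `|u| *: v).
rewrite !innerE (innerC v u) !inner_norm => uv.
have uv0 : 0 < 2 * (`|u| * `|v|) by rewrite mulr_gt0// mulr_gt0.
rewrite -(ler_pM2l uv0); lra.
Qed.

End InnerProduct.

(** * Riesz representation *)

Section Riesz.
Context {R : realType} {H : hilbertType R}.

(** The representing vector is the minimizer of the energy |h|^2 / 2 - phi h,
whose first-order optimality condition says exactly that it represents phi. *)
Theorem riesz_representation (phi : {linear H -> R^o}) :
  continuous phi -> exists g : H, forall h, phi h = inner g h.
Proof.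
move=> phi_cont.
have /linear_boundedP/pinfty_ex_gt0[M M0 phiM] :=
  continuous_linear_bounded 0 (phi_cont 0).
pose J (h : H) : R := `|h| ^+ 2 / 2 - phi h.
have J_ge h : - (M ^+ 2 / 2) <= J h.
  have := phiM h; have := ler_norm (phi h : R).
  rewrite /J; have := sqr_ge0 (`|h| - M); rewrite sqrrB => *; nra.
have J_inf : has_inf (range J).
  split; first by exists (J 0), 0.
  by exists (- (M ^+ 2 / 2)) => _ [h _ <-]; exact: J_ge.
pose m := inf (range J).
have J_ge_m h : m <= J h by apply: ge_inf; [exact: J_inf.2|exists h].
have /choice[u uP] n : exists h, J h < m + n.+1%:R^-1.
  have n0 : (0 : R) < n.+1%:R^-1 by rewrite invr_gt0.
  have [_ [h _ <-] Jh] := inf_adherent n0 J_inf.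
  by exists h.
(* The parallelogram identity makes every minimizing sequence Cauchy. *)
have J_mid h k : `|h - k| ^+ 2 <= 4 * (J h + J k - 2 * m).
  have := J_ge_m (2^-1 *: (h + k)).
  rewrite /J linearZ linearD -!inner_norm /= !innerE (innerC k h).
  rewrite -[_ *: _]/(_ * _); lra.
have : cvg (u @ \oo).
  (* 8 = 4 * 2: J_mid contributes the factor 4, and each of the two indices is
     within 1 / N.+1 of the infimum. *)
  apply/cauchy_cvgP/cauchy_exP => e e0.
  have d0 : 0 < e ^+ 2 / 8 by rewrite divr_gt0// exprn_gt0.
  have [N NP] : exists N : nat, (N.+1%:R^-1 : R) < e ^+ 2 / 8.
    have [N _ /(_ N (leqnn N))] := near_infty_natSinv_lt (PosNum d0).
    by exists N.
  exists (u N); exists N => // n /= Nn.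
  rewrite -ball_normE /ball_ /=.
  rewrite -(@ltr_pXn2r _ 2)// ?nnegrE ?normr_ge0 ?(ltW e0)//.
  have := J_mid (u N) (u n); have := uP N; have := uP n.
  have : (n.+1%:R^-1 : R) <= N.+1%:R^-1.
    by rewrite lef_pV2 ?posrE// ler_nat.
  move: NP; clear.
  by move: (N.+1%:R^-1) (n.+1%:R^-1) (J (u N)) (J (u n)) => a b c d; lra.
move=> /cvg_ex[g ug].
have J_cvg : J (u n) @[n --> \oo] --> J g.
  apply: cvgB; last exact: (cvg_comp _ _ ug (phi_cont g)).
  by apply: cvgMl; apply: cvgM; apply: cvg_norm.
have Jg : J g <= m.
  apply/ler_addgt0Pr => e e0.
  have e20 : 0 < e / 2 by lra.
  near \oo => n.
  have : (n.+1%:R^-1 : R) < (PosNum e20)%:num.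
    by near: n; exact: near_infty_natSinv_lt.
  have : `|J g - J (u n)| < e / 2.
    near: n; exact: (@cvgr_dist_lt _ _ _ _ _ _ _ J_cvg).
  rewrite ltr_norml /= => /andP[_].
  have := uP n; clear.
  by move: (n.+1%:R^-1) (J (u n)) (J g) => a b c; lra.
exists g => h.
(* First-order optimality, tested with the step that would decrease J most. *)
have [->|h0] := eqVneq h 0.
  by rewrite linear0 -[X in inner _ X](scale0r (0 : H)) innerZr mul0r.
have nh : 0 < inner h h by rewrite inner_norm exprn_gt0// normr_gt0.
pose t := (phi h - inner g h) / inner h h.
have th : t * inner h h = phi h - inner g h by rewrite divfK// gt_eqF.
have := le_trans Jg (J_ge_m (g + t *: h)).
rewrite /J linearD linearZ -!inner_norm /= !innerE (innerC h g).
rewrite -[_ *: _]/(_ * _) => ineq.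
have : (phi h - inner g h) ^+ 2 <= 0.
  rewrite -th; have : t * (t * inner h h) = t * (phi h - inner g h).
    by rewrite th.
  nra.
by rewrite -th; nra.
Unshelve. all: by end_near. Qed.

End Riesz.

(** * First-order inequalities for smooth convex functions *)

Section SmoothConvex.
Context {R : realType} {H : hilbertType R}.
Implicit Types (f : H -> R) (x y z d : H).

Lemma gradientP f x : differentiable f x ->
  forall h, 'd f x h = inner (gradient f x) h.
Proof.
move=> fx.
have [g gP] := riesz_representation ('d f x) (diff_continuous fx).
by apply: (@getPex _ [set g : H | forall h, 'd f x h = inner g h]); exists g.
Qed.

Lemma is_derive_line f x d (t : R) : differentiable f (x + t *: d) ->
  is_derive t 1 (fun r : R => f (x + r *: d))
    (inner (gradient f (x + t *: d)) d).
Proof.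
move=> fxt.
have [dfd dfE] : derivable f (x + t *: d) d /\
    'D_d f (x + t *: d) = inner (gradient f (x + t *: d)) d.
  by split; [exact: diff_derivable|rewrite deriveE// gradientP].
have quotE : (fun h : R => h^-1 *: (f (x + (h *: 1 + t) *: d) - f (x + t *: d)))
  = (fun h : R => h^-1 *: (f (h *: d + (x + t *: d)) - f (x + t *: d))).
  apply/funext => h; congr (_ *: (f _ - _)).
  by rewrite -[h *: 1]/(h * 1) mulr1 scalerDl addrCA.
split; first by rewrite /derivable /= quotE.
by rewrite -dfE /derive /= quotE.
Qed.

(** Convexity bounds every difference quotient from x towards z by f z - f x;
the derivative is their limit from the right. *)
Lemma convex_ge_tangent f x z :
  convex_function [set: convex_lmodType H] f -> differentiable f x ->
  f x + inner (gradient f x) (z - x) <= f z.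
Proof.
move=> f_convex fx; rewrite -lerBrDl.
have fx0 : differentiable f (x + 0 *: (z - x)) by rewrite scale0r addr0.
have [df dE] := is_derive_line _ _ _ _ fx0.
move: dE; rewrite scale0r addr0 => <-.
have /cvg_dnbhs_at_right dcvg := df.
apply: (cvgr_to_le dcvg).
near=> t.
have t0 : 0 < t by near: t; exact: nbhs_right_gt.
have t1 : t <= 1 by near: t; exact: nbhs_right_ltW.
have t01 : 0 <= t <= 1 by rewrite ltW.
rewrite /= -[_ *: _]/(_ * _) -[t *: 1]/(t * 1) mulr1 !addr0 scale0r addr0.
rewrite mulrC ler_pdivrMr//.
have := f_convex (Itv01 (ltW t0) t1) z x; rewrite !inE => /(_ I I).
rewrite !convRE /= => ft.
have -> : x + t *: (z - x) = t *: z + (1 - t) *: x.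
  by apply: inner_inj => w; rewrite !innerE; ring.
by move: ft; rewrite /conv /= -[unstable.onem t]/(1 - t); lra.
Unshelve. all: by end_near. Qed.

Lemma lipschitz_gradient f L x z : L.-lipschitz (gradient f) ->
  `|gradient f x - gradient f z| <= L * `|x - z|.
Proof. by move=> /(_ (x, z)) /=; apply. Qed.

(** Along the segment from x to z, f minus the quadratic upper model has a
nonpositive derivative by Cauchy-Schwarz and the Lipschitz bound. *)
Lemma descent_lemma f L x z : (forall x, differentiable f x) ->
  L.-lipschitz (gradient f) ->
  f z <= f x + inner (gradient f x) (z - x) + L / 2 * `|z - x| ^+ 2.
Proof.
move=> f_diff f_lip; set d := z - x.
have slope_le0 (p q n t : R) :
    p - q <= L * t * n -> p - q * 1 - L / 2 * n * (2 * t * 1) <= 0.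
  by lra.
pose c := L / 2 * `|d| ^+ 2.
pose a := inner (gradient f x) d.
pose g : R -> R := (fun t : R => f (x + t *: d)) - a \*: id - c \*: (id ^+ 2).
have gE t : g t = f (x + t *: d) - a * t - c * t ^+ 2.
  by rewrite /g !fctE.
(* The factors 1 are the derivative of the identity, kept so that the type of
   gd is literally what the derivation rules produce. *)
have gd (t : R) : is_derive t 1 g (inner (gradient f (x + t *: d)) d
   - a * 1 - c * (2 * t * 1)).
  have := is_derive_line f x d t (f_diff _).
  move=> ?; apply: is_deriveB.
have g_le : {in `]0, 1[%R, forall t : R, derive1 g t <= 0}.
  move=> t; rewrite in_itv /= => /andP[t0 _].
  rewrite derive1E (@derive_val _ _ _ _ _ _ _ (gd t)).
  apply: slope_le0; rewrite -innerNl -innerDl.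
  have xdx : x + t *: d - x = t *: d by rewrite (addrAC x) subrr add0r.
  apply: le_trans (inner_le_norm _ _) _; rewrite expr2 mulrA ler_wpM2r//.
  apply: le_trans (lipschitz_gradient f L (x + t *: d) x f_lip) _.
  by rewrite xdx normrZ gtr0_norm// mulrA.
have := @ler0_derive1_le_cc _ g 0 1 _ g_le _ 1 0.
rewrite !in_itv /= !lexx ler01 => /(_ _ _ isT isT isT).
rewrite !gE scale0r scale1r addr0 /d subrKC -/d -/a -/c => g10.
suff : f z - a * 1 - c * 1 ^+ 2 <= f x - a * 0 - c * 0 ^+ 2 by lra.
apply: g10.
  by move=> t _; case: (gd t).
by apply: derivable_within_continuous => t _; case: (gd t).
Qed.

(** The tangent plane at x lies below f at every point, in particular at the
point w reached from z by a step of length 1 / L against the difference of the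
gradients, where the quadratic model of f at z is smallest relative to that
plane. *)
Lemma convex_ge_tangent_gradient f L x z :
  convex_function [set: convex_lmodType H] f ->
  (forall x, differentiable f x) ->
  0 < L -> L.-lipschitz (gradient f) ->
  f x + inner (gradient f x) (z - x)
    + (2 * L)^-1 * `|gradient f z - gradient f x| ^+ 2 <= f z.
Proof.
move=> f_convex f_diff L0 f_lip.
have key (p q w : H) (a b : R) : w = z - L^-1 *: (q - p) ->
    a + inner p (w - x) <= b + inner q (w - z) + L / 2 * `|w - z| ^+ 2 ->
    a + inner p (z - x) + (2 * L)^-1 * `|q - p| ^+ 2 <= b.
  move=> ->; rewrite (addrAC z _ (- x)) (addrAC z _ (- z)) subrr add0r.
  rewrite -!inner_norm -(subr_ge0 _ b) -(subr_ge0 (a + _)).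
  move=> /le_trans; apply; rewrite le_eqVlt !innerE (innerC q p).
  by apply/orP; left; apply/eqP; field; rewrite gt_eqF.
apply: (key _ _ _ _ _ erefl).
exact: le_trans (convex_ge_tangent _ _ _ f_convex (f_diff x))
  (descent_lemma _ _ _ _ f_diff f_lip).
Qed.

End SmoothConvex.

(** * Sequences with bounded weighted sums *)

Section WeightedSums.
Context {R : realType}.
Implicit Types (u e r : nat -> R) (M C : R).

(** The bound telescopes from the index K on, and the value of e that remains at
the upper end is nonnegative. *)
Lemma bounded_sum_of_decrease {u e C} {K : nat} :
  (forall k, 0 <= u k) -> 0 <= C -> (forall k, 0 <= e k) ->
  (forall k, (K <= k)%N -> u k <= C * (e k - e k.+1)) ->
  exists M, forall n, \sum_(0 <= k < n) u k <= M.
Proof.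
move=> u0 C0 e0 ue; exists (\sum_(0 <= k < K) u k + C * e K) => n.
have tail m : \sum_(K <= k < K + m) u k <= C * (e K - e (K + m)%N).
  elim: m => [|m IH]; first by rewrite addn0 big_geq// subrr mulr0.
  rewrite addnS big_nat_recr ?leq_addr//=.
  by have := ue (K + m)%N (leq_addr _ _); lra.
apply: (@le_trans _ _ (\sum_(0 <= k < K + n) u k)).
  rewrite [leRHS](@big_cat_nat _ _ _ n)//= ?leq_addl// lerDl.
  by apply: sumr_ge0 => i _; exact: u0.
rewrite (@big_cat_nat _ _ _ K)//= ?leq_addr// lerD2l.
by have := tail n; have := mulr_ge0 C0 (e0 (K + n)%N); lra.
Qed.

Lemma bounded_nneseries_lty {u M} (m : nat) : (forall k, 0 <= u k) ->
  (forall n, \sum_(0 <= k < n) u k <= M) ->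
  (\sum_(m <= k <oo) (u k)%:E < +oo)%E.
Proof.
move=> u0 uM.
have u0E k : (m <= k)%N -> true -> (0%:E <= (u k)%:E)%E by rewrite lee_fin.
apply: (@le_lt_trans _ _ M%:E); last exact: ltry.
apply: (lime_le (is_cvg_nneseries u0E)).
apply: nearW => n; rewrite sumEFin lee_fin.
apply: (le_trans _ (uM n)).
have [mn|nm] := leqP m n; last by rewrite big_geq ?(ltnW nm)// sumr_ge0.
by rewrite [leRHS](@big_cat_nat _ _ _ m)//= lerDr sumr_ge0.
Qed.

Lemma bounded_sum_cvg0 {u M} : (forall k, 0 <= u k) ->
  (forall n, \sum_(0 <= k < n) u k <= M) -> u k @[k --> \oo] --> (0 : R).
Proof.
move=> u0 uM; apply: cvg_series_cvg_0.
apply: nondecreasing_is_cvgn.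
  by apply: nondecreasing_series => n _ _; exact: u0.
by exists M => _ [n _ <-]; rewrite /series /= uM.
Qed.

Lemma weighted_sum_littleo {r M} : (forall k, 0 <= r k) ->
  (forall n, \sum_(0 <= k < n) k%:R ^+ 2 * r k ^+ 2 <= M) ->
  r =o_\oo (fun k => k%:R^-1 : R).
Proof.
move=> r0 rM; apply/eqoP => e e0.
have u0 k : 0 <= k%:R ^+ 2 * r k ^+ 2 by rewrite mulr_ge0 ?sqr_ge0.
have := bounded_sum_cvg0 u0 rM.
have e20 : 0 < e ^+ 2 by rewrite exprn_gt0.
move=> /cvgr_dist_lt /(_ _ e20) rlt.
near=> k.
have k0 : 0 < k%:R :> R by rewrite ltr0n; near: k; exact: nbhs_infty_gt.
rewrite ger0_norm// normfV gtr0_norm// ler_pdivlMr//.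
rewrite -(@ler_pXn2r _ 2)// ?nnegrE ?(ltW e0) ?mulr_ge0 ?(ltW k0)//.
rewrite exprMn mulrC ltW//.
have : `|0 - k%:R ^+ 2 * r k ^+ 2| < e ^+ 2 by near: k.
by rewrite sub0r normrN ger0_norm.
Unshelve. all: by end_near. Qed.

Lemma running_min_le u (k i : nat) : (1 <= i <= k)%N -> running_min u k <= u i.
Proof.
move=> /andP[i1 ik]; rewrite /running_min.
apply: ge_bigmin_seq => //.
by rewrite mem_index_iota i1 ltnS.
Qed.

(** Each square is at least the increment of the left side because
3 n^2 + 3 n + 1 <= 3 (n + 1)^2. *)
Lemma sum_sqr_ge (n : nat) :
  n%:R ^+ 3 / 3 <= \sum_(0 <= k < n.+1) k%:R ^+ 2 :> R.
Proof.
elim: n => [|n IH]; first by rewrite big_nat1 expr0n mul0r.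
rewrite big_nat_recr//=; apply: (le_trans _ (lerD IH (lexx _))).
rewrite -natr1; have : 0 <= n%:R :> R by [].
by move: (n%:R) => a; nra.
Qed.

(** The running minimum bounds every term of the sum from below, so it can be
factored out, leaving a sum of squares of order k^3. *)
Lemma running_min_bigO {r M} :
  (forall n, \sum_(0 <= k < n) k%:R ^+ 2 * r k ^+ 2 <= M) ->
  running_min (fun i => r i ^+ 2) =O_\oo (fun k => k%:R ^- 3 : R).
Proof.
move=> rM; apply/eqO_exP.
have M0 : 0 <= M by have := rM 0%N; rewrite big_geq.
(* The summand 1 only makes the constant positive. *)
exists (3 * M + 1); first by lra.
near=> k.
have k0 : 0 < k%:R :> R by rewrite ltr0n; near: k; exact: nbhs_infty_gt.
have k30 : 0 < k%:R ^+ 3 :> R by rewrite exprn_gt0.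
set m := running_min _ k.
have m0 : 0 <= m.
  rewrite /m /running_min.
  apply: (big_ind (fun a => 0 <= a)) => [|a b a0 b0|i _]; rewrite ?sqr_ge0//.
  by rewrite le_min a0.
rewrite ger0_norm// normfV gtr0_norm// ler_pdivlMr//.
suff : m * (k%:R ^+ 3 / 3) <= M by lra.
apply: le_trans (rM k.+1).
apply: (le_trans (ler_wpM2l m0 (sum_sqr_ge k))).
rewrite mulr_sumr !big_nat; apply: ler_sum => i /= ik.
have [->|i0] := posnP i; first by rewrite expr0n mulr0 mul0r.
by rewrite mulrC ler_wpM2l ?sqr_ge0// running_min_le ?i0.
Unshelve. all: by end_near. Qed.

End WeightedSums.

(** * The energy of the inertial scheme *)

Section VectorIdentities.
Context {R : realType} {H : hilbertType R}.
Implicit Types (x y g : H) (a b c m t : R).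

(** The left side is v_(k+1) with the gradient step y1 - c G1 substituted for
x_(k+1); what it adds to the extrapolated form of v_k is linear in that step. *)
Lemma momentum_identity x1 y1 g1 G1 xs b t c :
  x1 - xs + t *: (y1 - c *: G1 - x1 + b *: g1)
  = y1 - xs + (t - 1) *: (y1 - x1) + (t * b) *: g1 - (c * t) *: G1.
Proof. by apply: inner_inj => w; rewrite !innerE; ring. Qed.

(** The two hypotheses say that rescaling by t turns the momentum coefficient m
into u - 1 and the coefficient 1 - 1 / n of g0 into u, which matches the
velocity x1 - x0 + b g0 with the extrapolated point. *)
Lemma extrapolation_identity {x0 x1 g0 g1 xs : H} {b m n t u : R} :
  t * m = u - 1 -> t * (1 - n^-1) = u ->
  x0 - xs + u *: (x1 - x0 + b *: g0)
  = x1 + m *: (x1 - x0) - b *: (g1 - g0) - (b / n) *: g0 - xs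
    + (t - 1) *: (x1 + m *: (x1 - x0) - b *: (g1 - g0) - (b / n) *: g0 - x1)
    + (t * b) *: g1.
Proof.
move=> tm tn; apply: inner_inj => w; rewrite !innerE.
move: (inner x0 w) (inner x1 w) (inner g0 w) (inner g1 w) (inner xs w).
move=> X0 X1 G0 G1 S.
have -> : X0 + - S + u * (X1 + - X0 + b * G0)
    = X1 - S + (u - 1) * (X1 - X0) + b * (u * G0) by ring.
by rewrite -tm -{1}tn; ring.
Qed.

End VectorIdentities.

Section Energy.
Context {R : realType} {H : hilbertType R}.
Context {f : H -> R} {L alpha beta s : R} {x y : nat -> H}.
Hypothesis f_convex : convex_function [set: convex_lmodType H] f.
Hypothesis f_diff : forall z : H, differentiable f z.
Hypothesis L_gt0 : 0 < L.
Hypothesis grad_lipschitz : L.-lipschitz (gradient f).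
Hypothesis alpha_ge3 : 3 <= alpha.
Hypothesis s_gt0 : 0 < s.
Hypothesis s_leV : s <= 1 / L.
Hypothesis xy_IGAHD : IGAHD f alpha beta s x y.

Local Notation g k := (gradient f (x k)).
Local Notation G k := (gradient f (y k)).
Local Notation t k := (tau alpha k.+1).
Local Notation v := (vseq f alpha beta s x).
Local Notation E := (energy f alpha beta s x).
Local Notation gamma := (beta * L * Num.sqrt s).

Lemma minvalE {xstar : H} : argmin f xstar -> minval f = f xstar.
Proof.
move=> xmin; apply/eqP; rewrite eq_le; apply/andP; split.
  by apply: ge_inf; [exists (f xstar) => _ [z _ <-]; exact: xmin|exists xstar].
by apply: lb_le_inf; [exists (f xstar), xstar|move=> _ [z _ <-]; exact: xmin].
Qed.

Let alphaB1_gt0 : 0 < alpha - 1. Proof. by move: alpha_ge3; lra. Qed.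

(** This form of v_k exhibits the three inner products with G that the expansion
of |v_(k+1)|^2 produces. *)
Lemma vseq_extrapolation {xstar k} : (1 <= k)%N ->
  v xstar k = y k - xstar + (t k - 1) *: (y k - x k)
              + (t k * (beta * Num.sqrt s)) *: g k.
Proof.
case: k => // k _; have [-> _] := xy_IGAHD k.+1 isT.
have k1 : k%:R + 1 != 0 :> R by rewrite natr1 pnatr_eq0.
have a1 : alpha - 1 != 0 by rewrite gt_eqF.
have t_momentum : t k.+1 * (1 - alpha / k.+1%:R) = tau alpha k.+1 - 1.
  by rewrite /tau -[k.+2%:R]natr1 -[k.+1%:R]natr1; field; rewrite k1 a1.
have t_hessian : t k.+1 * (1 - k.+1%:R^-1) = tau alpha k.+1.
  by rewrite /tau -[k.+2%:R]natr1 -[k.+1%:R]natr1; field; rewrite k1 a1.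
exact: extrapolation_identity t_momentum t_hessian.
Qed.

Lemma vseq_succ {xstar k} : (1 <= k)%N ->
  v xstar k.+1 = v xstar k - (s * t k) *: G k.
Proof.
move=> k1; rewrite (vseq_extrapolation k1) /vseq /=.
have [_ ->] := xy_IGAHD k k1; exact: momentum_identity.
Qed.

(** The choice s <= 1 / L keeps half of the first-order decrease; this half is
what cancels the |G|^2 term of the squared norm of v. *)
Lemma gradient_step_decrease k : (1 <= k)%N ->
  f (x k.+1) <= f (y k) - s / 2 * `|G k| ^+ 2.
Proof.
move=> k1; have [_ xE] := xy_IGAHD k k1.
have := descent_lemma f L (y k) (x k.+1) f_diff grad_lipschitz.
rewrite xE (addrAC (y k)) subrr add0r innerNr innerZr normrN normrZ gtr0_norm//.
rewrite inner_norm => fx; apply: (le_trans fx).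
have sL : L * s <= 1 by rewrite mulrC -ler_pdivlMr.
have : 0 <= s * (1 - L * s) * `|G k| ^+ 2.
  by rewrite mulr_ge0 ?sqr_ge0// mulr_ge0 ?(ltW s_gt0)// subr_ge0.
by rewrite exprMn; move: (f (y k)) (`|G k| ^+ 2) => fy n; lra.
Qed.

(** The weight of f(x_k) - min f that the step creates does not exceed the one
that the energy provides; for large k this is exactly the role of alpha >= 3. *)
Lemma tau_recurrence k : t k * (t k - 1) <= tau alpha k ^+ 2.
Proof.
rewrite /tau -[k.+1%:R]natr1 addrK.
have -> : k%:R / (alpha - 1) * (k%:R / (alpha - 1) - 1) =
  ((k%:R - 1) / (alpha - 1)) ^+ 2
    - (k%:R * (alpha - 3) + 1) / (alpha - 1) ^+ 2.
  by field; rewrite gt_eqF.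
rewrite gerBl divr_ge0 ?sqr_ge0// addr_ge0// mulr_ge0//.
by move: alpha_ge3; lra.
Qed.

(** In the sum of the three inequalities, weighted by t^2, t and t (t - 1), the
values f(y_k) cancel. The bracket is
(1 - 1/t) |g - G|^2 + 2 gamma <g, G> in polarized form. *)
Lemma energy_step {xstar k} : argmin f xstar -> (1 <= k)%N -> 1 <= t k ->
  E xstar k.+1 + t k ^+ 2 / (2 * L)
    * (gamma / 2 * `|g k + G k| ^+ 2
       + (1 - gamma / 2 - (t k)^-1) * `|g k - G k| ^+ 2)
  <= E xstar k.
Proof.
(* The scalar part of the argument: T and b stand for t and sqrt s; B, D and V
   for the squared norms of G, g - G and v_k; p for the inner product of g and
   G; I1 and I2 for those of G with xstar - y_k and with x_k - y_k. *)
have combine (T tau2 B D V b p I1 I2 fx' fy fx fs : R) :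
    1 <= T -> T * (T - 1) <= tau2 -> fs <= fx -> fx' <= fy - s / 2 * B ->
    fy + I1 <= fs -> fy + I2 + (2 * L)^-1 * D <= fx ->
    T ^+ 2 * (fx' - fs) + (2 * s)^-1 *
      (V - 2 * (s * T) * (- I1 - (T - 1) * I2 + T * (beta * b) * p)
         + (s * T) ^+ 2 * B)
      + T ^+ 2 / (2 * L) * (beta * L * b / 2 * (D + 4 * p)
                            + (1 - beta * L * b / 2 - T^-1) * D)
    <= tau2 * (fx - fs) + (2 * s)^-1 * V.
  move=> T1 tau2T fmin next_le min_le prev_le.
  have T0 : 0 < T by apply: lt_le_trans T1.
  have -> : (2 * s)^-1 *
      (V - 2 * (s * T) * (- I1 - (T - 1) * I2 + T * (beta * b) * p)
         + (s * T) ^+ 2 * B) = (2 * s)^-1 * V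
    + (T * I1 + T * (T - 1) * I2 - T ^+ 2 * (beta * b) * p
       + s / 2 * T ^+ 2 * B).
    by field; rewrite gt_eqF.
  have -> : T ^+ 2 / (2 * L) * (beta * L * b / 2 * (D + 4 * p)
      + (1 - beta * L * b / 2 - T^-1) * D)
    = T * (T - 1) * ((2 * L)^-1 * D) + T ^+ 2 * (beta * b) * p.
    by field; rewrite !gt_eqF.
  have T10 : 0 <= T * (T - 1) by rewrite mulr_ge0 ?subr_ge0// ltW.
  rewrite -subr_ge0 in fmin.
  have := ler_wpM2r fmin tau2T.
  have := ler_wpM2l (sqr_ge0 T) next_le.
  have := ler_wpM2l (ltW T0) min_le.
  have := ler_wpM2l T10 prev_le.
  clear; lra.
have sub_norm (u w : H) (c : R) :
    `|u - c *: w| ^+ 2 = `|u| ^+ 2 - 2 * c * inner u w + c ^+ 2 * `|w| ^+ 2.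
  by rewrite -!inner_norm !innerE (innerC w u); ring.
have add_norm (u w : H) : `|u + w| ^+ 2 = `|u - w| ^+ 2 + 4 * inner u w.
  by rewrite -!inner_norm !innerE (innerC w u); ring.
have inner_v (p q x1 y1 : H) (T b : R) :
    inner (y1 - xstar + (T - 1) *: (y1 - x1) + (T * b) *: p) q
      = - inner q (xstar - y1) - (T - 1) * inner q (x1 - y1)
        + T * b * inner p q.
  by rewrite !innerE !(innerC q); ring.
move=> xmin k1 t1.
rewrite /energy vseq_succ// (minvalE xmin) sub_norm add_norm.
rewrite [X in inner X (G k)](vseq_extrapolation k1) inner_v.
apply: combine t1 (tau_recurrence k) (xmin _) (gradient_step_decrease k k1) _ _.
  exact: convex_ge_tangent f_convex (f_diff _).
exact: convex_ge_tangent_gradient f_convex f_diff L_gt0 grad_lipschitz.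
Qed.

Lemma energy_ge0 {xstar} k : argmin f xstar -> 0 <= E xstar k.
Proof.
move=> xmin; rewrite /energy (minvalE xmin).
apply: addr_ge0; apply: mulr_ge0; rewrite ?sqr_ge0 ?subr_ge0 ?invr_ge0//.
by rewrite mulr_ge0// ltW.
Qed.

(** For k >= 2 the weight tau_k^2 is at least a fixed fraction of k^2, because
k <= 2 (k - 1). *)
Lemma value_le_energy {xstar} k : argmin f xstar -> (2 <= k)%N ->
  k%:R ^+ 2 * (f (x k) - minval f) <= 4 * (alpha - 1) ^+ 2 * E xstar k.
Proof.
have shift_sqr (n : R) : 2 <= n -> n ^+ 2 <= 4 * (n - 1) ^+ 2 by nra.
move=> xmin k2; have fx : 0 <= f (x k) - minval f.
  by rewrite (minvalE xmin) subr_ge0 xmin.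
have tau_le : tau alpha k ^+ 2 * (f (x k) - minval f) <= E xstar k.
  by rewrite /energy lerDl mulr_ge0 ?sqr_ge0// invr_ge0 mulr_ge0// ltW.
apply: le_trans (ler_wpM2l _ tau_le); last by rewrite mulr_ge0 ?sqr_ge0.
rewrite mulrA; apply: ler_wpM2r fx _ _ _.
have -> : 4 * (alpha - 1) ^+ 2 * tau alpha k ^+ 2 = 4 * (k%:R - 1) ^+ 2.
  by rewrite /tau; field; rewrite gt_eqF.
by apply: shift_sqr; rewrite ler_nat.
Qed.

(** As t grows, the coefficients in [energy_step] tend to gamma/2 and
1 - gamma/2, both positive. The constant c is at most the first limit and at
most half of the second, so both coefficients are at least c once 1 / t <= c. *)
Lemma energy_decrease : 0 < gamma < 2 -> exists C K, [/\ 0 < C, (1 <= K)%N &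
  forall xstar k, argmin f xstar -> (K <= k)%N ->
    k%:R ^+ 2 * (`|g k| ^+ 2 + `|G k| ^+ 2)
      <= C * (E xstar k - E xstar k.+1)].
Proof.
have coefficient_ge (w c tV : R) : c <= w / 2 -> tV <= c -> c <= w - tV by lra.
move=> /andP[gamma0 gamma2].
pose c := Num.min (gamma / 2) ((1 - gamma / 2) / 2).
have c0 : 0 < c by rewrite lt_min; apply/andP; split; lra.
have cl : c <= gamma / 2 by rewrite ge_min lexx.
have cr : c <= (1 - gamma / 2) / 2 by rewrite ge_min lexx orbT.
(* Beyond this threshold t is at least 1 + c^-1, so that both 1 <= t and
   1 / t <= c hold. *)
have [K _ KP] := @nbhs_infty_ger R ((alpha - 1) * (1 + c^-1)).
exists ((alpha - 1) ^+ 2 * L / c), K.+1; split=> //.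
  by rewrite divr_gt0// mulr_gt0// exprn_gt0.
move=> xstar k xmin Kk.
have k1 : (1 <= k)%N by apply: leq_trans Kk.
have tE : t k = k%:R / (alpha - 1) by rewrite /tau -natr1 addrK.
have t_ge : 1 + c^-1 <= t k.
  by rewrite tE ler_pdivlMr// mulrC; apply: KP; exact: ltnW.
have cV0 : 0 < c^-1 by rewrite invr_gt0.
have t1 : 1 <= t k by lra.
have t0 : 0 < t k by lra.
have tV : (t k)^-1 <= c by rewrite invf_ple ?posrE//; lra.
have parallelogram (a b : H) :
    `|a + b| ^+ 2 + `|a - b| ^+ 2 = 2 * (`|a| ^+ 2 + `|b| ^+ 2).
  by rewrite -!inner_norm !innerE (innerC b a); ring.
have step := energy_step xmin k1 t1.
have k2 : k%:R ^+ 2 = (alpha - 1) ^+ 2 * t k ^+ 2.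
  by rewrite tE exprMn exprVn mulrC divfK// sqrf_eq0 gt_eqF.
have t2 : 0 <= t k ^+ 2 / (2 * L).
  by rewrite divr_ge0 ?sqr_ge0// mulr_ge0// ltW.
have quad : c * (2 * (`|g k| ^+ 2 + `|G k| ^+ 2))
    <= gamma / 2 * `|g k + G k| ^+ 2
       + (1 - gamma / 2 - (t k)^-1) * `|g k - G k| ^+ 2.
  rewrite -parallelogram mulrDr.
  apply: lerD; apply: ler_wpM2r (sqr_ge0 _) _ _ _; first exact: cl.
  exact: coefficient_ge cr tV.
have {}quad := ler_wpM2l t2 quad.
have -> : k%:R ^+ 2 * (`|g k| ^+ 2 + `|G k| ^+ 2)
    = (alpha - 1) ^+ 2 * L / c *
      (t k ^+ 2 / (2 * L) * (c * (2 * (`|g k| ^+ 2 + `|G k| ^+ 2)))).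
  rewrite k2; move: (`|g k| ^+ 2 + _) => S; field.
  by rewrite !gt_eqF.
rewrite ler_pM2l ?divr_gt0 ?mulr_gt0 ?exprn_gt0//.
rewrite lerBrDr addrC; apply: le_trans step.
by rewrite lerD2l.
Qed.

End Energy.

Theorem corollary5p4 (R : realType) (H : hilbertType R) (f : H -> R)
    (L alpha beta s : R) (x y : nat -> H)
    (f_convex : convex_function [set: convex_lmodType H] f)
    (f_diff : forall z : H, differentiable f z)
    (L_gt0 : 0 < L)
    (grad_lipschitz : L.-lipschitz (gradient f))
    (argmin_neq0 : argmin f !=set0)
    (alpha_ge3 : 3 <= alpha)
    (s_gt0 : 0 < s) (s_leV : s <= 1 / L)
    (beta_gt0 : 0 < beta)
    (xy_IGAHD : IGAHD f alpha beta s x y)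
    (bLs_gt0 : 0 < beta * L * Num.sqrt s)
    (bLs_lt2 : beta * L * Num.sqrt s < 2) :
  [/\ (forall xstar : H, argmin f xstar ->
         \forall k \near \oo,
           energy f alpha beta s x xstar k.+1
             <= energy f alpha beta s x xstar k),
      (fun k : nat => f (x k) - minval f) =O_\oo (fun k : nat => k%:R ^- 2 : R),
      (\sum_(1 <= k <oo) (k%:R ^+ 2 * `|gradient f (x k)| ^+ 2)%:E < +oo)%E
        /\ (\sum_(1 <= k <oo) (k%:R ^+ 2 * `|gradient f (y k)| ^+ 2)%:E
              < +oo)%E,
      (fun k : nat => `|gradient f (x k)|) =o_\oo (fun k : nat => k%:R ^-1 : R)
        /\ (fun k : nat => `|gradient f (y k)|)
             =o_\oo (fun k : nat => k%:R ^-1 : R)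
    & running_min (fun i => `|gradient f (x i)| ^+ 2)
          =O_\oo (fun k : nat => k%:R ^- 3 : R)
        /\ running_min (fun i => `|gradient f (y i)| ^+ 2)
             =O_\oo (fun k : nat => k%:R ^- 3 : R)].
Proof.
have bLs02 : 0 < beta * L * Num.sqrt s < 2 by rewrite bLs_gt0.
have [C [K [C0 K1 decr]]] := energy_decrease f_convex f_diff L_gt0
  grad_lipschitz alpha_ge3 s_gt0 s_leV xy_IGAHD bLs02.
have noninc xstar k : argmin f xstar -> (K <= k)%N ->
    energy f alpha beta s x xstar k.+1 <= energy f alpha beta s x xstar k.
  move=> xmin Kk; rewrite -subr_ge0 -(pmulr_rge0 _ C0).
  apply: le_trans (decr _ _ xmin Kk).
  exact: mulr_ge0 (sqr_ge0 _) (addr_ge0 (sqr_ge0 _) (sqr_ge0 _)).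
have [xs xmin] := argmin_neq0.
have e0 k : 0 <= energy f alpha beta s x xs k := energy_ge0 s_gt0 k xmin.
have sq0 (z : nat -> H) k : 0 <= k%:R ^+ 2 * `|gradient f (z k)| ^+ 2 :> R.
  exact: mulr_ge0 (sqr_ge0 _) (sqr_ge0 _).
have bounded (z : nat -> H) :
    (forall k, `|gradient f (z k)| ^+ 2
       <= `|gradient f (x k)| ^+ 2 + `|gradient f (y k)| ^+ 2) ->
    exists M, forall n,
      \sum_(0 <= k < n) k%:R ^+ 2 * `|gradient f (z k)| ^+ 2 <= M :> R.
  move=> zxy.
  apply: (bounded_sum_of_decrease (K := K) (sq0 z) (ltW C0) e0) => k Kk.
  apply: le_trans (decr _ _ xmin Kk).
  exact: ler_wpM2l (sqr_ge0 _) _ _ (zxy k).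
have [|Mx xM] := bounded x; first by move=> k; rewrite lerDl sqr_ge0.
have [|My yM] := bounded y; first by move=> k; rewrite lerDr sqr_ge0.
split.
- by move=> xstar xstar_min; exists K; [exact: I|move=> k; exact: noninc].
- have energy_le k : (K <= k)%N ->
      energy f alpha beta s x xs k <= energy f alpha beta s x xs K.
    move=> /subnKC <-; elim: (k - K)%N => [|m IH]; first by rewrite addn0.
    by rewrite addnS; apply: le_trans IH; apply: noninc; rewrite ?leq_addr.
  have a4 : 0 <= 4 * (alpha - 1) ^+ 2 by apply: mulr_ge0 (sqr_ge0 _).
  apply/eqO_exP.
  (* The summand 1 only makes the constant positive. *)
  exists (4 * (alpha - 1) ^+ 2 * energy f alpha beta s x xs K + 1).
    by apply: ltr_wpDl ltr01; apply: mulr_ge0 (e0 K).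
  near=> k.
  have Kk : (K <= k)%N by near: k; exists K.
  have k2 : (2 <= k)%N by near: k; exists 2%N.
  have k0 : 0 < k%:R ^+ 2 :> R by rewrite exprn_gt0// ltr0n; exact: ltnW.
  rewrite ger0_norm ?(minvalE xmin) ?subr_ge0 ?xmin// -(minvalE xmin).
  rewrite normfV gtr0_norm// ler_pdivlMr// mulrC.
  apply: le_trans (value_le_energy alpha_ge3 s_gt0 k xmin k2) _.
  apply: le_trans (ler_wpM2l a4 (energy_le k Kk)) _.
  by rewrite lerDl.
- by split; [exact: (bounded_nneseries_lty 1 (sq0 x) xM)
            |exact: (bounded_nneseries_lty 1 (sq0 y) yM)].
- by split; apply: weighted_sum_littleo; [|exact: xM| |exact: yM].
- by split; [exact: running_min_bigO xM|exact: running_min_bigO yM].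
Unshelve. all: by end_near. Qed.
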